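(* Let $\theta$ be an infinite cardinal, and let $\alpha$ and $\beta$ be ordinals with $\alpha<(2^\theta)^+$ and $\beta$ limit. Define a sequence $(\Gamma(\xi):\xi\le\beta)$ by $\Gamma(0)=2$, $\Gamma(\xi+1)=\big((\Gamma(\xi))^{|\alpha|^{\theta}}\big)^{++}$ (cardinal exponentiation, and $\lambda^{++}$ is the second cardinal successor of $\lambda$), and $\Gamma(\nu)=\sup_{\xi<\nu}\Gamma(\xi)$ for limit $\nu$. Let $\Gamma=\Gamma(\beta)$. Suppose $\mathfrak M_0$ and $\mathfrak M_1$ are two structures in the same vocabulary. If Eve has a winning strategy in the game $\mathrm{DG}^{\Gamma}_{2^\theta,\alpha}(\mathfrak M_0,\mathfrak M_1)$, then Eve has a winning strategy in the game $\mathrm{DG}^{\beta}_{\theta,\omega}(\mathfrak M_0,\mathfrak M_1)$.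
   Context: Structures are single-sorted algebraic structures. $M_i$ denotes the universe of $\mathfrak M_i$; $M_0$ and $M_1$ are always assumed disjoint (otherwise replace the structures by disjoint isomorphic copies). $[X]^{\le\theta}$ is the set of subsets of $X$ of cardinality at most $\theta$. A partial isomorphism from $\mathfrak M_0$ to $\mathfrak M_1$ is an injective partial map $g$ from $M_0$ to $M_1$ preserving, in both directions, the truth of atomic formulas. Given ordinals $\alpha,\beta$ and an infinite cardinal $\theta$, a $(\beta,\theta,\alpha)$-position is a tuple $p=(\beta_p,A_p^0,A_p^1,g_p,h_p)$ where: $\beta_p\le\beta$ is an ordinal; $A_p^0\in[M_0]^{\le\theta}$, $A_p^1\in[M_1]^{\le\theta}$; $g_p$ is a partial function from $A_p^0$ to $A_p^1$ that is a partial isomorphism; $h_p:A_p^0\cup A_p^1\to\alpha$ (values are ordinals $<\alpha$); and $h_p^{-1}(0)\cap A_p^0\subseteq\mathrm{dom}(g_p)$, $h_p^{-1}(0)\cap A_p^1\subseteq\mathrm{ran}(g_p)$. A position $q$ extends $p$, written $q<p$, if $\beta_q<\beta_p$; $A_q^0\supseteq A_p^0$ and $A_q^1\supseteq A_p^1$; $g_q\supseteq g_p$; and for every $a\in A_p^0\cup A_p^1$, $h_q(a)\le h_p(a)$, with $h_q(a)<h_p(a)$ if $h_p(a)>0$. The game $\mathrm{DG}^\beta_{\theta,\alpha}(\mathfrak M_0,\mathfrak M_1)$ between Adam and Eve starts at position $(\beta,\emptyset,\emptyset,\emptyset,\emptyset)$. If the current position is $p$: Adam chooses $\beta'<\beta_p$,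 $B_0\in[M_0]^{\le\theta}$ and $B_1\in[M_1]^{\le\theta}$; Eve then chooses a position $q<p$ with $\beta_q=\beta'$, $B_0\subseteq A_q^0$, $B_1\subseteq A_q^1$, which becomes the next position. The player who cannot move loses and the opponent wins. *)

(* Defs.v *)
From HB Require Import structures.
From mathcomp Require Import all_boot all_order.
From mathcomp Require Import mathcomp_extra boolp classical_sets functions.
From mathcomp Require Import cardinality.
Set Implicit Arguments.
Unset Strict Implicit.
Unset Printing Implicit Defensive.
Import Order.TTheory.
Local Open Scope order_scope.
Local Open Scope classical_set_scope.
Local Open Scope card_scope.

(* [Node f] denotes the least ordinal strictly above all the [f i]; [Ord] is
   the quotient of these trees by "denotes the same ordinal".  The facts
   [ord_wf], [ord_small_bound] and [ord_seg_small] say that [Ord] is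
   well-ordered, that every family indexed by a type of the universe of [A] has
   a strict upper bound, and that initial segments are that small: [Ord]
   consists of the ordinals of that universe. *)

Inductive tree : Type := Node (A : Type) (f : A -> tree).

Fixpoint tle (s t : tree) : Prop :=
  match s, t with
  | @Node A f, @Node B g => forall i : A, exists j : B, tle (f i) (g j)
  end.

Lemma tle_refl t : tle t t.
Proof. by elim: t => I f IH /= i; exists i. Qed.

Lemma tle_trans s t u : tle s t -> tle t u -> tle s u.
Proof.
elim: s t u => I f IH [J g] [K h] /= st tu i.
by have [j /IH fg] := st i; have [k /fg] := tu j; exists k.
Qed.

Definition tlt (s t : tree) : Prop :=
  match t with @Node B g => exists j : B, tle s (g j) end.

Lemma tltNge s t : ~ tle t s <-> tlt s t.
Proof.
have H u v : (tle u v \/ tlt v u) /\ (tle v u \/ tlt u v).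
  elim: u v => I f IHu; elim=> J g IHv; split.
    have [[i Hi]|Hn] := EM (exists i, tle (Node g) (f i)); first by right; exists i.
    left=> i; have [_ [C|//]] := IHu i (Node g).
    by case: Hn; exists i.
  have [[j Hj]|Hn] := EM (exists j, tle (Node f) (g j)); first by right; exists j.
  left=> j; have [[C|//] _] := IHv j.
  by case: Hn; exists j.
split=> [nts|]; first by case: (H t s) => -[].
case: t => J g [j sgj] ts; move: (tle_trans ts sgj) => {s sgj ts}.
suff K u : forall (A : Type) (k : A -> tree) a, u = k a -> ~ tle (Node k) u.
  exact: K.
elim: u => I f IH A k a E /= le; have [i] := le a; rewrite -E.
exact: (IH i I f i).
Qed.

Lemma tltW s t : tlt s t -> tle s t.
Proof.
elim: s t => I f IH [J g] [j fg] /= i; exists j; apply: IH.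
by move: fg; case: (g j) => K h /= /(_ i).
Qed.

Definition teq : rel {classic tree} := fun s t => `[< tle s t /\ tle t s >].

Lemma teq_equiv : equiv_class_of teq.
Proof.
split=> [s|s t|t s u].
- by apply/asboolP; split; exact: tle_refl.
- by apply/asboolP/asboolP => -[].
- move=> /asboolP[st ts] /asboolP[tu ut]; apply/asboolP.
  by split; [exact: tle_trans st tu | exact: tle_trans ut ts].
Qed.

Canonical teq_equivRel := EquivRelPack teq_equiv.

Definition Ord : Type := {eq_quot teq_equivRel}%qT.
HB.instance Definition _ := Choice.on Ord.

Definition ord_of (t : tree) : Ord := (\pi_({eq_quot teq_equivRel}) (t : {classic tree}))%qT.
Definition tree_of (a : Ord) : tree := (repr (a : {eq_quot teq_equivRel}))%qT.

Definition ord_le (a b : Ord) : bool := `[< tle (tree_of a) (tree_of b) >].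

Lemma tree_ofK a : ord_of (tree_of a) = a.
Proof. exact: reprK. Qed.

Lemma ord_ofK t : teq (tree_of (ord_of t)) t.
Proof. by apply/eqmodP; rewrite reprK. Qed.

Lemma ord_le_refl : reflexive ord_le.
Proof. by move=> a; apply/asboolP; exact: tle_refl. Qed.

Lemma ord_le_anti : antisymmetric ord_le.
Proof.
move=> a b /andP[/asboolP ab /asboolP ba].
by rewrite -(tree_ofK a) -(tree_ofK b); apply/eqmodP/asboolP.
Qed.

Lemma ord_le_trans : transitive ord_le.
Proof.
by move=> b a c /asboolP ab /asboolP bc; apply/asboolP; exact: tle_trans ab bc.
Qed.

Fact ord_display : Order.disp_t. Proof. exact: Order.Disp tt tt. Qed.
HB.instance Definition _ :=
  Order.Le_isPOrder.Build ord_display Ord ord_le_refl ord_le_anti ord_le_trans.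


Lemma ord_le_total : total (<=%O : rel Ord).
Proof.
move=> a b; apply/orP.
have [ab|/tltNge/tltW ba] := EM (tle (tree_of a) (tree_of b)).
  by left; apply/asboolP.
by right; apply/asboolP.
Qed.
HB.instance Definition _ :=
  Order.POrder_isTotal.Build ord_display Ord ord_le_total.

Lemma ord_ltP (a b : Ord) : (a < b) <-> tlt (tree_of a) (tree_of b).
Proof.
rewrite ltNge; split=> [/asboolP/tltNge //|/tltNge nba].
exact/asboolP.
Qed.

Lemma ord_wf : well_founded (fun a b : Ord => a < b).
Proof.
suff H t (a : Ord) : tle (tree_of a) t -> Acc (fun a b : Ord => a < b) a.
  by move=> a; apply: (H (tree_of a)); exact: tle_refl.
elim: t a => I f IH a at_; constructor=> b /ord_ltP ba.
have : tlt (tree_of b) (Node f).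
  by apply/tltNge => fb; move/tltNge: ba; apply; exact: tle_trans at_ fb.
by move=> [i]; exact: IH.
Qed.

Lemma tlt_node (I : Type) (f : I -> tree) i : tlt (f i) (Node f).
Proof. by exists i; exact: tle_refl. Qed.

Lemma ord_small_bound (I : Type) (f : I -> Ord) : exists b, forall i, f i < b.
Proof.
pose t := Node (fun i => tree_of (f i)); exists (ord_of t) => i.
apply/ord_ltP/tltNge => tf.
have /asboolP[_ tt'] := ord_ofK t.
by have /tltNge := tlt_node (fun i => tree_of (f i)) i; apply; exact: tle_trans tt' tf.
Qed.

Lemma ord_seg_small (a : Ord) :
  exists (I : Type) (f : I -> Ord), forall b, b < a -> exists i, b = f i.
Proof.
suff H t : exists (I : Type) (f : I -> Ord),
    forall b, tlt (tree_of b) t -> exists i, b = f i.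
  by have [I [f Hf]] := H (tree_of a); exists I, f => b /ord_ltP/Hf.
pose fix idx t : Type := match t with @Node A f => {x : A & option (idx (f x))} end.
pose fix val t : idx t -> tree := match t return idx t -> tree with
  | @Node A f => fun p => match projT2 p with
      | Some q => val (f (projT1 p)) q
      | None => f (projT1 p)
      end end.
exists (idx t), (fun p => ord_of (val t p)) => b.
suff {b} K s : tlt s t -> exists p, teq s (val t p).
  move=> /K[p bp]; exists p; rewrite -(tree_ofK b).
  exact/eqmodP.
elim: t s => A f IH s [x sx].
have [xs|/tltNge /IH[p sp]] := EM (tle (f x) s).
  by exists (existT _ x None); apply/asboolP.
by exists (existT _ x (Some p)).
Qed.

(* The least element of [P], which exists as soon as [P] is inhabited. *)
Definition least (P : set Ord) : Ord :=
  xget (ord_of (Node (fun x : False => match x with end)))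
       [set a | P a /\ forall b, P b -> a <= b].

Lemma leastP (P : set Ord) a : P a ->
  P (least P) /\ forall b, P b -> least P <= b.
Proof.
move=> Pa; suff : exists c, P c /\ forall b, P b -> c <= b.
  by move=> /(xgetPex (ord_of (Node (fun x : False => match x with end)))).
elim/(well_founded_ind ord_wf): a Pa => a IH Pa.
have [[b [Pb ba]]|Hn] := EM (exists b, P b /\ b < a); first exact: IH ba Pb.
exists a; split=> // b Pb; rewrite leNgt; apply/negP => ba.
by apply: Hn; exists b.
Qed.

Definition seg (a : Ord) : set Ord := [set b | b < a].

Definition ozero : Ord := least setT.
Definition osucc (a : Ord) : Ord := least [set b | a < b].
Definition otwo : Ord := osucc (osucc ozero).
Definition osup (P : set Ord) : Ord := least [set b | forall a, P a -> a <= b].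

Lemma ozero_le a : ozero <= a.
Proof. by have [_] := @leastP setT a Logic.I; apply. Qed.

Lemma osuccP (a b : Ord) : (b < osucc a) = (b <= a).
Proof.
have [c /(_ tt) ac] := ord_small_bound (fun _ : unit => a).
have [/= aS minS] := @leastP [set b | a < b] c ac.
apply/idP/idP => [bS|ba]; last exact: le_lt_trans ba aS.
by rewrite leNgt; apply/negP => ab; have := minS _ ab; rewrite leNgt bS.
Qed.

Lemma lt_osucc (a : Ord) : a < osucc a.
Proof. by rewrite osuccP. Qed.

Lemma osucc_inj : injective osucc.
Proof.
move=> a b ab; apply/eqP; rewrite eq_le -!osuccP ab lt_osucc /=.
by rewrite -ab lt_osucc.
Qed.

(* [osup] is a genuine supremum for images of initial segments. *)
Lemma osup_segP (xi : Ord) (F : Ord -> Ord) :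
  let s := osup [set a | exists2 eta : Ord, eta < xi & a = F eta] in
  (forall eta : Ord, eta < xi -> F eta <= s) /\
  (forall c : Ord, (forall eta : Ord, eta < xi -> F eta <= c) -> s <= c).
Proof.
have [A [f fP]] := ord_seg_small xi.
have [b Fb] := ord_small_bound (F \o f).
have [|ub lub] := @leastP
  [set b | forall a, (exists2 eta : Ord, eta < xi & a = F eta) -> a <= b] b.
  by move=> _ [eta /fP[i ->] ->]; exact/ltW/Fb.
split=> [eta ex|c Fc]; first by apply: ub; exists eta.
by apply: lub => _ [eta ex ->]; exact: Fc.
Qed.

Definition is_limit (a : Ord) : Prop :=
  a <> ozero /\ forall b, a <> osucc b.

Definition omega : Ord := least is_limit.

Definition is_cardinal (k : Ord) : Prop :=
  forall a, a < k -> ~ (seg a #= seg k).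

Definition infinite_cardinal (k : Ord) : Prop := is_cardinal k /\ omega <= k.

Definition ocard (T : Type) (A : set T) : Ord := least [set a | A #= seg a].

Definition csucc (k : Ord) : Ord := least [set l | is_cardinal l /\ k < l].

Definition cexp (k l : Ord) : Ord := ocard [set: seg l -> seg k].

Definition Gamma_next (theta alpha k : Ord) : Ord :=
  csucc (csucc (cexp k (cexp (ocard (seg alpha)) theta))).

Definition Gamma_step (theta alpha xi : Ord)
    (G : forall eta : Ord, eta < xi -> Ord) : Ord :=
  if xi == ozero then otwo else
  match pselect (exists eta (h : eta < xi), xi = osucc eta) with
  | left ex => Gamma_next theta alpha (G _ (projT1 (cid (projT2 (cid ex)))))
  | right _ => osup [set a | exists eta (h : eta < xi), a = G eta h]
  end.

Definition Gamma (theta alpha : Ord) : Ord -> Ord :=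
  Fix ord_wf (fun=> Ord) (Gamma_step theta alpha).

Lemma GammaE theta alpha xi :
  Gamma theta alpha xi =
  Gamma_step theta alpha (fun eta (_ : eta < xi) => Gamma theta alpha eta).
Proof.
rewrite /Gamma Fix_eq // => {}xi F G FG; congr Gamma_step.
by apply: functional_extensionality_dep => eta; exact: functional_extensionality_dep.
Qed.

(* [Gamma] is determined by [Gamma0], [GammaS] and [Gamma_limit]; see
   [osup_segP] for the supremum in the latter. *)
Lemma Gamma0 theta alpha : Gamma theta alpha ozero = otwo.
Proof. by rewrite GammaE /Gamma_step eqxx. Qed.

Lemma GammaS theta alpha xi :
  Gamma theta alpha (osucc xi) =
  csucc (csucc (cexp (Gamma theta alpha xi) (cexp (ocard (seg alpha)) theta))).
Proof.
rewrite GammaE /Gamma_step ifF; last first.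
  by apply/negbTE/negP => /eqP E; have := lt_osucc xi; rewrite E ltNge ozero_le.
case: pselect => [ex|[]]; last by exists xi, (lt_osucc xi).
by rewrite -(osucc_inj (projT2 (cid (projT2 (cid ex))))).
Qed.

Lemma Gamma_limit theta alpha nu : is_limit nu ->
  Gamma theta alpha nu =
  osup [set a | exists2 xi : Ord, xi < nu & a = Gamma theta alpha xi].
Proof.
move=> [/eqP nu0 nuS]; rewrite GammaE /Gamma_step (negbTE nu0).
case: pselect => [[eta [_ /nuS]]//|_].
by congr osup; apply/seteqP; split=> a; [move=> [xi [h ->]]|move=> [xi h ->]]; exists xi.
Qed.

Record vocabulary := Vocabulary {
  fsym : Type; farity : fsym -> nat;
  rsym : Type; rarity : rsym -> nat }.

Record structure (L : vocabulary) := Structure {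
  univ :> Type;
  finterp : forall f : fsym L, ('I_(farity f) -> univ) -> univ;
  rinterp : forall r : rsym L, ('I_(rarity r) -> univ) -> Prop }.

Inductive term (L : vocabulary) (n : nat) :=
| Var of 'I_n
| App (f : fsym L) of ('I_(farity f) -> term L n).

Inductive atomic (L : vocabulary) (n : nat) :=
| Eq of term L n & term L n
| Rel (r : rsym L) of ('I_(rarity r) -> term L n).

Fixpoint eval (L : vocabulary) (M : structure L) n (v : 'I_n -> M)
    (t : term L n) : M :=
  match t with
  | Var i => v i
  | @App _ _ f args => finterp (fun i => eval v (args i))
  end.

Definition sat (L : vocabulary) (M : structure L) n (v : 'I_n -> M)
    (phi : atomic L n) : Prop :=
  match phi with
  | Eq s t => eval v s = eval v t
  | @Rel _ _ r args => rinterp (fun i => eval v (args i))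
  end.

Section Game.
Variables (L : vocabulary) (M0 M1 : structure L).

(* The case [n = 0] covers atomic sentences. *)
Definition partial_iso (g : M0 -> option M1) : Prop :=
  (forall x x' y, g x = Some y -> g x' = Some y -> x = x') /\
  (forall n (phi : atomic L n) (v : 'I_n -> M0) (w : 'I_n -> M1),
     (forall i, g (v i) = Some (w i)) -> (sat v phi <-> sat w phi)).

(* [M0 + M1] is the disjoint union of the universes.  [height] stands for a
   function on the part of it given by [dom0] and [dom1]; its values elsewhere
   are never looked at. *)
Record position := Position {
  clock : Ord;
  dom0 : set M0;
  dom1 : set M1;
  pmap : M0 -> option M1;
  height : M0 + M1 -> Ord }.

Definition dom (p : position) : set (M0 + M1) :=
  [set z | match z with inl x => dom0 p x | inr y => dom1 p y end].

Definition is_position (beta theta alpha : Ord) (p : position) : Prop :=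
  [/\ clock p <= beta,
      dom0 p #<= seg theta /\ dom1 p #<= seg theta,
      partial_iso (pmap p) /\
        (forall x y, pmap p x = Some y -> dom0 p x /\ dom1 p y),
      (forall z, dom p z -> height p z < alpha) &
      (forall x, dom0 p x -> height p (inl x) = ozero ->
         exists y, pmap p x = Some y) /\
      (forall y, dom1 p y -> height p (inr y) = ozero ->
         exists x, pmap p x = Some y)].

Definition extends (q p : position) : Prop :=
  [/\ clock q < clock p,
      dom0 p `<=` dom0 q /\ dom1 p `<=` dom1 q,
      (forall x y, pmap p x = Some y -> pmap q x = Some y) &
      (forall z, dom p z -> height q z <= height p z /\
         (ozero < height p z -> height q z < height p z))].

Definition start (beta : Ord) : position :=
  Position beta set0 set0 (fun=> None) (fun=> ozero).

Record move := Move { mclock : Ord; mset0 : set M0; mset1 : set M1 }.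

Definition adam_legal (theta : Ord) (p : position) (m : move) : Prop :=
  [/\ mclock m < clock p, mset0 m #<= seg theta & mset1 m #<= seg theta].

Definition eve_legal (beta theta alpha : Ord) (p : position) (m : move)
    (q : position) : Prop :=
  [/\ is_position beta theta alpha q, extends q p, clock q = mclock m,
      mset0 m `<=` dom0 q & mset1 m `<=` dom1 q].

(* A strategy of Eve maps the sequence of all moves made so far by Adam to her
   answer to the last one.  [played sigma ms p] says that [p] is the current
   position after Adam made the legal moves [ms] and Eve answered each of them,
   legally, by [sigma]. *)
Definition strategy := seq move -> position.

Inductive played (beta theta alpha : Ord) (sigma : strategy) :
    seq move -> position -> Prop :=
| played_nil : played beta theta alpha sigma [::] (start beta)
| played_rcons ms p m : played beta theta alpha sigma ms p ->
    adam_legal theta p m ->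
    eve_legal beta theta alpha p m (sigma (rcons ms m)) ->
    played beta theta alpha sigma (rcons ms m) (sigma (rcons ms m)).

(* Clocks strictly decrease, so every play is finite and is lost by the player
   who cannot move: [sigma] wins iff it always provides a legal answer. *)
Definition winning (beta theta alpha : Ord) (sigma : strategy) : Prop :=
  forall ms p m, played beta theta alpha sigma ms p -> adam_legal theta p m ->
    eve_legal beta theta alpha p m (sigma (rcons ms m)).

Definition eve_wins (beta theta alpha : Ord) : Prop :=
  exists sigma : strategy, winning beta theta alpha sigma.

End Game.

(* Main.v *)
Require Import Defs.
From mathcomp Require Import all_boot all_order.
From mathcomp Require Import mathcomp_extra boolp classical_sets functions.
From mathcomp Require Import cardinality.
Set Implicit Arguments.
Unset Strict Implicit.
Unset Printing Implicit Defensive.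
Import Order.TTheory.
Local Open Scope order_scope.
Local Open Scope classical_set_scope.
Local Open Scope card_scope.

(** Suppose that Eve wins the long game, with clock [Gamma beta], sets of size
    [2 ^ theta] and heights below [alpha], but that the start of the short game is
    not winning for her.  Then every lost position of the short game has a
    refutation by Adam, after which all positions are lost ([refutationP]).

    Fix a winning way for Eve to play the long game, and let Adam decide there on
    the clocks in all possible ways.  This gives a tree of positions of rank
    [Gamma beta] ([node_rank]).  Next to each position of this tree stands a family
    of positions of the short game: Eve copies the map, restricted to a set of size
    [theta], and chooses finite heights freely.  As there are only
    [omega ^ theta = 2 ^ theta] choices, Adam can play the union of all his
    refutations as a single move of the long game ([joint_small]), so that the
    answer of Eve covers each of the simulated plays.

    It remains to find one simulated play in which Eve answers legally to the end
    ([transfer]).  An ordinal height below [alpha] does not say after how many moves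
    an element enters the map, because this number depends on the clocks that Adam
    chooses.  A partition theorem for trees removes the dependence ([homogeneous]):
    if [S] is the set of functions from sequences of colours to [lam + 1], then a
    tree of rank greater than the cardinality of [S], in the sense of [csucc], has a
    subtree of rank greater than [lam] where the colour of a node depends only on its
    level.  Colour the nodes by the heights of the [theta] elements in question.  On
    a homogeneous subtree the heights at successive levels form, for each element, a
    single decreasing sequence of ordinals.  This sequence reaches [0] after a number
    of steps that is known in advance, and the number is the finite height that Eve
    declares.  She then passes to a child of large rank in the subtree.

    The recursion for [Gamma] makes this work at each clock of the short game: by
    [colour_card], the inner [csucc] in [Gamma (osucc xi)] is a bound for [S] when
    [lam = Gamma xi], and the outer one is the rank that the tree theorem requires. *)

(** * Embeddings of types *)

Definition embeds (A B : Type) : Prop := exists f : A -> B, injective f.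

Lemma emb_trans A B C : embeds A B -> embeds B C -> embeds A C.
Proof. by move=> [f fi] [g gi]; exists (g \o f); exact: inj_comp. Qed.

Lemma emb_funr (Y A B : Type) : embeds A B -> embeds (Y -> A) (Y -> B).
Proof.
move=> [f fi]; exists (fun u y => f (u y)) => u v E.
by apply: funext => y; apply: fi; exact: (congr1 (fun w => w y) E).
Qed.

Lemma emb_retract (A B : Type) (a : A) (f : A -> B) : injective f ->
  exists g : B -> A, cancel f g.
Proof.
move=> fi; exists (fun b => if pselect (exists a, f a = b) is left h
                            then projT1 (cid h) else a) => x.
case: pselect => [h|[]]; last by exists x.
exact: fi (projT2 (cid h)).
Qed.

Lemma emb_funl (Y A B : Type) : inhabited A -> embeds A B -> embeds (A -> Y) (B -> Y).
Proof.
move=> [a] [f fi]; have [g gK] := emb_retract a fi.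
exists (fun u b => u (g b)) => u v E; apply: funext => x.
by rewrite -(gK x); exact: (congr1 (fun w => w (f x)) E).
Qed.

Lemma emb_uncurry (A B Y : Type) : embeds (A -> B -> Y) (A * B -> Y).
Proof.
exists (fun u p => u p.1 p.2) => u v E; apply: funext => a; apply: funext => b.
exact: (congr1 (fun w => w (a, b)) E).
Qed.

Lemma emb_pair_fun (A Y : Type) : embeds ((A -> Y) * (A -> Y)) (bool * A -> Y).
Proof.
exists (fun u p => if p.1 then u.1 p.2 else u.2 p.2) => -[u u'] [v v'] E.
congr pair; apply: funext => a.
  exact: (congr1 (fun w => w (true, a)) E).
exact: (congr1 (fun w => w (false, a)) E).
Qed.

Lemma sub_emb (T U : Type) (A : set T) (B : set U) (f : T -> U) :
  (forall x, A x -> B (f x)) -> (forall x y, A x -> A y -> f x = f y -> x = y) ->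
  embeds A B.
Proof.
move=> fAB fi.
exists (fun x : A => SigSub (mem_set (fAB _ (set_mem (valP x)))) : B).
move=> x y /(congr1 val) /= E; apply: val_inj; apply: fi => //; exact: set_mem (valP _).
Qed.

Lemma card_leE (T U : Type) (A : set T) (B : set U) : (A #<= B) <-> embeds A B.
Proof.
split=> [/card_leP[f]|[f fi]].
  by exists f => x y; apply: inj; rewrite inE.
by apply/card_leP/injfunPex; exists f => // x y _ _; exact: fi.
Qed.

Lemma card_eqE (T U : Type) (A : set T) (B : set U) :
  (A #= B) <-> embeds A B /\ embeds B A.
Proof.
rewrite card_eq_le; split=> [/andP[/card_leE ? /card_leE ?]|[? ?]] //.
by apply/andP; split; apply/card_leE.
Qed.

Lemma emb_setT (T : Type) : embeds [set: T] T.
Proof. by exists val; exact: val_inj. Qed.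

Lemma setT_emb (T : Type) : embeds T [set: T].
Proof. by exists (fun x => SigSub (mem_set (Logic.I : [set: T] x))) => x y [->]. Qed.

(** * Cardinals exist *)

Lemma seg_emb (a b : Ord) : a <= b -> embeds (seg a) (seg b).
Proof. by move=> ab; apply: (@sub_emb _ _ _ _ id) => // x /lt_le_trans; apply. Qed.

Lemma seg_small (a : Ord) : exists I : Type, embeds (seg a) I.
Proof.
have [I [f fP]] := ord_seg_small a.
exists I; have /choice[g gP] : forall x : seg a, exists i, val x = f i.
  by move=> x; exact: fP (set_valP x).
by exists g => x y /(congr1 f); rewrite -!gP => /val_inj.
Qed.

Lemma strict_mono_ge (b : Ord) (F : Ord -> Ord) :
  (forall x y, x < y -> y < b -> F x < F y) -> forall x, x < b -> x <= F x.
Proof.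
move=> Fm; elim/(well_founded_ind ord_wf) => x IH xb.
rewrite leNgt; apply/negP => Fx.
have := IH _ Fx (lt_trans Fx xb); rewrite leNgt.
by rewrite Fm.
Qed.

(** A relation on [I] that orders its field like [seg a] determines [a], and the
    relations on [I] form a type of the same universe as [I]; so the ordinals [a]
    with [seg a] embedded in [I] have a strict bound. *)
Lemma hartogs (I : Type) : exists a : Ord, ~ embeds (seg a) I.
Proof.
(* The relation is reflexive on the range of [j], so that [R] remembers that
   range even when [a] is a singleton. *)
pose code (R : I -> I -> Prop) (a : Ord) := exists j : seg a -> I, injective j /\
  forall i i', R i i' <-> exists x y, [/\ j x = i, j y = i' & val x <= val y].
pose phi R := xget ozero [set a | code R a].
have [b phib] := ord_small_bound phi; exists b => -[j ji].
pose R i i' := exists x y, [/\ j x = i, j y = i' & val x <= val y].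
have : code R (phi R) by apply: (xgetPex ozero); exists b, j.
move: (phib R); set a := phi R => ab [j' [j'i RP]].
have /choice[f fP] : forall x : seg b, exists x', j' x' = j x.
  by move=> x; have /RP[x' [? []]] : R (j x) (j x) by [exists x, x]; exists x'.
pose F x := if pselect (seg b x) is left h then val (f (SigSub (mem_set h))) else x.
have FE x (h : seg b x) : F x = val (f (SigSub (mem_set h))).
  by rewrite /F; case: pselect => // h'; rewrite (Prop_irrelevance h h').
have Fm x y : x < y -> y < b -> F x < F y.
  move=> xy yb; have xb : x < b := lt_trans xy yb.
  rewrite (FE _ xb) (FE _ yb) lt_neqAle; apply/andP; split.
    apply/eqP => /val_inj/(congr1 j'); rewrite !fP => /ji [E].
    by rewrite E ltxx in xy.
  have /RP[x' [y' [+ + le]]] :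
      R (j (SigSub (mem_set (xb : seg b x)))) (j (SigSub (mem_set (yb : seg b y)))).
    by do 2!eexists; split; [reflexivity|reflexivity|exact: ltW].
  by rewrite -!fP => /j'i <- /j'i <-.
have := strict_mono_ge Fm ab; rewrite (FE _ ab) leNgt.
by rewrite (set_valP (f _)).
Qed.

Lemma csuccP (k : Ord) : is_cardinal (csucc k) /\ k < csucc k.
Proof.
have [I kI] := seg_small k; have [a0 a0I] := hartogs I.
have a0k : ~ embeds (seg a0) (seg k) by move=> /emb_trans/(_ kI).
pose P := [set a | ~ embeds (seg a) (seg k)].
have [Pa min] := @leastP P a0 a0k; set a := least P in Pa min.
apply: (proj1 (@leastP [set l | is_cardinal l /\ k < l] a _)); split.
  move=> b ba /card_eqE[_ ab]; have: a <= b by apply: min => /(emb_trans ab).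
  by rewrite leNgt ba.
by rewrite ltNge; apply/negP => /seg_emb.
Qed.

Lemma csucc_not_emb (k : Ord) : ~ embeds (seg (csucc k)) (seg k).
Proof.
have [card lt] := csuccP k; move=> H; apply: (card _ lt).
by apply/card_eqE; split=> //; exact: seg_emb (ltW lt).
Qed.

Lemma emb_lt_csucc (a k : Ord) : embeds (seg a) (seg k) -> a < csucc k.
Proof.
move=> ak; rewrite ltNge; apply/negP => /seg_emb /emb_trans/(_ ak).
exact: csucc_not_emb.
Qed.

(** Elements of [T] are enumerated without repetition along [Ord].  The
    enumeration stops, since otherwise every ordinal would embed into [I]. *)
Lemma card_exists (I T : Type) : embeds T I -> exists a : Ord, [set: T] #= seg a.
Proof.
move=> TI; have [b bI] := hartogs I.
pose step (x : Ord) (G : forall y : Ord, y < x -> option T) : option T :=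
  if pselect (exists t, ~ exists y (h : y < x), G y h = Some t) is left h
  then Some (projT1 (cid h)) else None.
pose F := Fix ord_wf (fun=> option T) step.
have FE x : F x = step x (fun y _ => F y).
  rewrite /F Fix_eq // => {}x f g fg; congr step.
  by apply: functional_extensionality_dep => y; exact: functional_extensionality_dep.
have Fnone x : F x = None -> forall t, exists2 y, y < x & F y = Some t.
  rewrite FE /step; case: pselect => // H _ t; apply: contrapT => nt.
  by apply: H; exists t => -[y [h E]]; apply: nt; exists y.
have Fsome x y t : F x = Some t -> y < x -> F y <> Some t.
  rewrite FE /step; case: pselect => // h [<-] yx E.
  by apply: (projT2 (cid h)); exists y, yx.
have inj x : (forall y, y < x -> F y <> None) -> embeds (seg x) T.
  move=> Hx; have /choice[g gP] : forall y : seg x, exists t, F (val y) = Some t.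
    by move=> y; case E: (F _) => [t|]; [exists t|case: (Hx _ (set_valP y))].
  exists g => y z E; apply: val_inj; have Ey := gP y; have Ez := gP z.
  rewrite -E in Ez; case: (ltgtP (val y) (val z)) => // l.
    by case: (Fsome _ _ _ Ez l).
  by case: (Fsome _ _ _ Ey l).
have [x0 Fx0] : exists x, F x = None.
  apply: contrapT => H; apply: bI; apply: emb_trans TI; apply: inj => y _ E.
  by apply: H; exists y.
have [Fx min] := @leastP [set x | F x = None] x0 Fx0.
set x := least _ in Fx min; exists x; apply/card_eqE; split; last first.
  apply: emb_trans (setT_emb _); apply: inj => y yx Fy; have := min _ Fy.
  by rewrite leNgt yx.
apply: emb_trans (emb_setT _) _.
have /choice[g gP] : forall t, exists y : seg x, F (val y) = Some t.
  by move=> t; have [y yx E] := Fnone _ Fx t; exists (SigSub (mem_set (yx : seg x y))).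
by exists g => s t E; have := gP s; rewrite E gP => -[].
Qed.

Lemma ocardP (T : Type) (A : set T) (a : Ord) : A #= seg a -> A #= seg (ocard A).
Proof. by move=> Aa; have [] := @leastP [set a | A #= seg a] a Aa. Qed.

Lemma cexpP (k l : Ord) :
  embeds (seg l -> seg k) (seg (cexp k l)) /\ embeds (seg (cexp k l)) (seg l -> seg k).
Proof.
have [I kI] := seg_small k; have [J lJ] := seg_small l.
have [K HK] : exists K : Type, embeds (seg l -> seg k) K.
  have [i0|l0] := EM (inhabited (seg l)).
    exists (J -> I); exact: emb_trans (emb_funr _ kI) (emb_funl _ i0 lJ).
  exists unit; exists (fun=> tt) => u v _; apply: funext => x.
  by case: l0; constructor.
have [a /ocardP/card_eqE[H1 H2]] := card_exists HK.
split; first exact: emb_trans (setT_emb _) H1.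
exact: emb_trans H2 (emb_setT _).
Qed.

Lemma ocard_segP (a : Ord) :
  embeds (seg a) (seg (ocard (seg a))) /\ embeds (seg (ocard (seg a))) (seg a).
Proof. by apply/card_eqE; apply: (@ocardP _ _ a); exact: card_eqxx. Qed.

(** * Arithmetic of an infinite cardinal *)

Definition natO (n : nat) : Ord := iter n osucc ozero.

Lemma lt_natO_S n : natO n < natO n.+1.
Proof. exact: lt_osucc. Qed.

Lemma natO_lt m n : (m < n)%N -> natO m < natO n.
Proof.
elim: n => // n IH; rewrite ltnS leq_eqVlt => /orP[/eqP->|/IH]; first exact: lt_natO_S.
by move=> /lt_trans; apply; exact: lt_natO_S.
Qed.

Lemma natO_le m n : (m <= n)%N -> natO m <= natO n.
Proof. by rewrite leq_eqVlt => /orP[/eqP->//|/natO_lt/ltW]. Qed.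

Lemma natO_eq0 n : natO n = ozero -> n = 0%N.
Proof. by case: n => // n E; have := lt_natO_S n; rewrite E ltNge ozero_le. Qed.

Lemma limit_osucc a b : is_limit a -> b < a -> osucc b < a.
Proof.
move=> [_ aS] ba; rewrite lt_neqAle; apply/andP; split; first by apply/eqP => /esym/aS.
by rewrite leNgt osuccP -ltNge.
Qed.

Lemma limit_gt0 a : is_limit a -> ozero < a.
Proof. by move=> [/eqP a0 _]; rewrite lt_neqAle eq_sym a0 ozero_le. Qed.

Lemma limit_iter a b n : is_limit a -> b < a -> iter n osucc b < a.
Proof. by move=> la ba; elim: n => //= n IH; exact: limit_osucc. Qed.

Lemma natO_inj : injective natO.
Proof.
by move=> m n E; case: (ltngtP m n) => // /natO_lt; rewrite E ltxx.
Qed.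

Definition nonsucc (l : Ord) := forall b, l <> osucc b.

Lemma ord_decomp (x : Ord) : exists p : Ord * nat, nonsucc p.1 /\ x = iter p.2 osucc p.1.
Proof.
elim/(well_founded_ind ord_wf): x => x IH.
have [[b xb]|H] := EM (exists b, x = osucc b).
  have [|[l n] [/= ln E]] := IH b; first by rewrite xb lt_osucc.
  by exists (l, n.+1); rewrite /= -E.
by exists (x, 0%N); split=> // b xb; apply: H; exists b.
Qed.

Lemma decomp_inj l l' n n' : nonsucc l -> nonsucc l' ->
  iter n osucc l = iter n' osucc l' -> (l, n) = (l', n').
Proof.
move=> nl nl'; elim: n n' => [|n IH] [|n'] //=; first by move->.
- by move=> /nl.
- by move=> /esym/nl'.
by move=> /osucc_inj/IH[-> ->].
Qed.

Lemma iter_ge x n : x <= iter n osucc x.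
Proof. by elim: n => //= n IH; rewrite (le_trans IH) // ltW // lt_osucc. Qed.

(** Every ordinal is [l + n] with [l] not a successor and [n] finite, and a limit
    ordinal is closed under changing [n]; so [k] can be coded into [n]. *)
Lemma limit_mul_nat (t : Ord) : is_limit t -> embeds (nat * seg t) (seg t).
Proof.
move=> lt; have /choice[d dP] := ord_decomp.
have dt (x : Ord) (k : nat) : x < t -> iter (pickle (k, (d x).2)) osucc (d x).1 < t.
  move=> xt; apply: limit_iter => //; apply: le_lt_trans xt.
  by rewrite [leRHS](proj2 (dP x)) iter_ge.
exists (fun p : nat * seg t => SigSub (mem_set (dt (val p.2) p.1 (set_valP p.2) : seg t _))).
move=> [k x] [m y] /(congr1 val) /= /decomp_inj.
case/(_ (proj1 (dP _)) (proj1 (dP _))) => E /(pcan_inj pickleK)[-> E2].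
congr pair; apply: val_inj.
by rewrite (proj2 (dP (val x))) (proj2 (dP (val y))) E E2.
Qed.

Section InfiniteCardinal.
Variable theta : Ord.
Hypothesis theta_inf : infinite_cardinal theta.
Hypothesis omega_lim : is_limit omega.

(** If [theta = b + 1] with [b] infinite, moving the top element to [0] and each
    finite [n] to [n + 1] embeds [theta] into [b]. *)
Lemma infinite_limit : is_limit theta.
Proof.
have [card om] := theta_inf; split=> [t0|b tb].
  by have := lt_le_trans (limit_gt0 omega_lim) om; rewrite t0 ltxx.
have bt : b < theta by rewrite tb lt_osucc.
have ob : omega <= b.
  by rewrite leNgt; apply/negP => /(limit_osucc omega_lim); rewrite -tb ltNge om.
apply: (card _ bt); apply/card_eqE; split; first exact: seg_emb (ltW bt).
have nb n : natO n < b by apply: lt_le_trans ob; exact: limit_iter (limit_gt0 _).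
pose F x := if x == b then ozero else
  if pselect (exists n, x = natO n) is left _ then osucc x else x.
apply: (@sub_emb _ _ _ _ F) => [x|x y].
  rewrite /seg /= tb osuccP le_eqVlt /F; case: eqP => [_ _|_ /= xb].
    exact: (nb 0%N).
  by case: pselect => // -[n ->]; exact: (nb n.+1).
move=> _ _; rewrite /F; case: eqP => [->|xb]; case: eqP => [->|yb] //.
- case: pselect => [[n ->] E|H E].
    by have := @natO_eq0 n.+1 (esym E).
  by case: H; exists 0%N.
- case: pselect => [[n ->] E|H E].
    by have := @natO_eq0 n.+1 E.
  by case: H; exists 0%N.
case: pselect => [[n ->]|H]; case: pselect => [[m ->]|H'] //.
- exact: osucc_inj.
- by move=> E; case: H'; exists n.+1.
- by move=> E; case: H; exists m.+1.
Qed.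

Lemma theta_mul_nat : embeds (nat * seg theta) (seg theta).
Proof. exact: limit_mul_nat infinite_limit. Qed.

Lemma theta_inhab : inhabited (seg theta).
Proof.
by constructor; exact: SigSub (mem_set (limit_gt0 infinite_limit : seg theta ozero)).
Qed.

Lemma theta_mul_bool : embeds (bool * seg theta) (seg theta).
Proof.
apply: emb_trans theta_mul_nat.
exists (fun p => (nat_of_bool p.1, p.2)) => -[a x] [b y] /= [E ->].
by move: E; case: a; case: b.
Qed.

Lemma pow_nat (Y : Type) : embeds (nat -> seg theta -> Y) (seg theta -> Y).
Proof.
apply: emb_trans (emb_uncurry _ _ _) _; apply: emb_funl theta_mul_nat.
by case: theta_inhab => x; constructor; exact: (0%N, x).
Qed.

Lemma pow_square (Y : Type) :
  embeds ((seg theta -> Y) * (seg theta -> Y)) (seg theta -> Y).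
Proof.
apply: emb_trans (emb_pair_fun _ _) _; apply: emb_funl theta_mul_bool.
by case: theta_inhab => x; constructor; exact: (true, x).
Qed.

Lemma pow_nat_base : embeds (seg theta -> nat) (seg theta -> bool).
Proof.
apply: emb_trans (pow_nat _); exists (fun u n x => u x == n) => u v E.
by apply: funext => x; apply/eqP; rewrite (congr1 (fun w => w (v x) x) E).
Qed.

Lemma pow_theta : embeds (seg theta) (seg theta -> bool).
Proof.
exists (fun x y => x == y) => x y E; apply/eqP.
by rewrite (congr1 (fun w => w y) E).
Qed.

Lemma card_pow2 :
  embeds (seg theta -> bool) (seg (cexp otwo theta)) /\
  embeds (seg (cexp otwo theta)) (seg theta -> bool).
Proof.
have [H1 H2] := cexpP otwo theta; split.
  apply: emb_trans H1; apply: emb_funr.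
  have h0 : seg otwo ozero by apply: (@natO_lt 0 2).
  have h1 : seg otwo (natO 1) by apply: (@natO_lt 1 2).
  exists (fun b : bool => if b then SigSub (mem_set h1) else SigSub (mem_set h0)).
  by move=> [] [] // /(congr1 val) E; [have := @natO_inj 1 0 E | have := @natO_inj 0 1 E].
apply: emb_trans H2 _; apply: emb_funr.
exists (fun x : seg otwo => val x == ozero) => x y E; apply: val_inj.
have H (z : seg otwo) : val z = ozero \/ val z = osucc ozero.
  have := set_valP z; rewrite /seg /= /otwo osuccP le_eqVlt osuccP.
  move=> /orP[/eqP->|z0]; first by right.
  by left; apply/eqP; rewrite eq_le z0 ozero_le.
move: E; have S0 : (osucc ozero == ozero) = false by rewrite gt_eqF // lt_osucc.
by case: (H x) => ->; case: (H y) => ->; rewrite ?eqxx ?S0.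
Qed.

End InfiniteCardinal.

(** * The growth of Gamma *)

Lemma Gamma_limit_ge2 theta alpha nu : is_limit nu -> otwo <= Gamma theta alpha nu.
Proof.
move=> nul; rewrite Gamma_limit //.
apply: le_trans (proj1 (osup_segP _ _) ozero (limit_gt0 nul)).
by rewrite Gamma0.
Qed.

Section ColourCount.
Variables (theta alpha : Ord).
Hypothesis theta_inf : infinite_cardinal theta.
Hypothesis omega_lim : is_limit omega.
Hypothesis alpha_gt0 : ozero < alpha.

Let kappa := cexp (ocard (seg alpha)) theta.
Let Q := seg theta -> seg alpha.

Let Q_kappa : embeds Q (seg kappa).
Proof.
have [H _] := cexpP (ocard (seg alpha)) theta; apply: emb_trans H.
exact: emb_funr (proj1 (ocard_segP alpha)).
Qed.

Let a0 : seg alpha := SigSub (mem_set (alpha_gt0 : seg alpha ozero)).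

Lemma base_lt_pow (lam : Ord) : lam < csucc (cexp lam kappa).
Proof.
apply: emb_lt_csucc; apply: emb_trans (proj1 (cexpP lam kappa)).
exists (fun x _ => x) => x y E; have [f _] := Q_kappa.
exact: (congr1 (fun w => w (f (fun=> a0))) E).
Qed.

(** [nat -> Z -> seg alpha] is the type of sequences of colours.  If there are at
    least two colours, then there are at most [kappa] such sequences, and since
    [lam + 1 <= lam ^ kappa] the exponent is absorbed.  If there is only one
    colour, the left side is [lam + 1], which can be more than [lam ^ kappa] when
    [lam] is finite; hence the successor cardinal on the right. *)
Lemma colour_card (Z : Type) (lam : Ord) : embeds Z (seg theta) -> otwo <= lam ->
  embeds ((nat -> Z -> seg alpha) -> seg (osucc lam)) (seg (csucc (cexp lam kappa))).
Proof.
move=> Zt lam2; pose C := Z -> seg alpha.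
have [sub|nsub] := EM (forall c c' : C, c = c').
  apply: (@emb_trans _ (seg (osucc lam))).
    exists (fun F => F (fun _ _ => a0)) => F G E; apply: funext => c.
    suff -> : c = (fun _ _ => a0) by [].
    by apply: funext => n; exact: sub.
  by apply: seg_emb; rewrite leNgt osuccP -ltNge; exact: base_lt_pow.
have [c [c' cc']] : exists c c' : C, c <> c'.
  apply: contrapT => H; apply: nsub => c c'; apply: contrapT => cc'.
  by apply: H; exists c, c'.
have [z0] : inhabited Z.
  apply: contrapT => H; apply: cc'; apply: funext => z; case: H; exact: inhabits z.
have [i ii] : embeds C Q by apply: emb_funl Zt; exact: inhabits z0.
have nCQ : embeds (nat -> C) Q.
  by apply: emb_trans (pow_nat theta_inf omega_lim _); apply: emb_funr; exists i.
(* [x < lam] goes to the function with constant value [x], and [lam] itself to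
   [top], which is not constant. *)
have YQ : embeds (seg (osucc lam)) (Q -> seg lam).
  have h0 : seg lam ozero by apply: lt_le_trans lam2; exact: (@natO_lt 0 2).
  have h1 : seg lam (osucc ozero) by apply: lt_le_trans lam2; exact: (@natO_lt 1 2).
  pose top (q : Q) := if pselect (q = i c) then SigSub (mem_set h0)
                     else SigSub (mem_set h1) : seg lam.
  have top0 : val (top (i c)) = ozero by rewrite /top; case: pselect.
  have top1 : val (top (i c')) = osucc ozero.
    by rewrite /top; case: pselect => [E|//]; case: cc'; exact/esym/ii.
  have topP (x : seg lam) : top <> fun=> x.
    by move=> E; have := lt_osucc ozero; rewrite -top1 -{1}top0 E ltxx.
  pose g (x : seg (osucc lam)) := if pselect (val x < lam) is left h
    then fun=> SigSub (mem_set (h : seg lam (val x))) else top.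
  exists g => x y; rewrite /g; case: pselect => hx; case: pselect => hy.
  - by move=> /(congr1 (fun w => w (i c)))/(congr1 val) /= /val_inj.
  - by move=> /esym/topP.
  - by move=> /topP.
  have H (z : seg (osucc lam)) : ~ (val z < lam) -> val z = lam.
    have := set_valP z; rewrite /seg /= osuccP le_eqVlt.
    by move=> /orP[/eqP|].
  by move=> _; apply: val_inj; rewrite (H x) // (H y).
apply: emb_trans (seg_emb (ltW (proj2 (csuccP _)))).
apply: emb_trans (proj1 (cexpP lam kappa)).
apply: (@emb_trans _ (Q -> seg (osucc lam))).
  apply: emb_funl nCQ; exact: inhabits (fun=> c).
apply: emb_trans (emb_funr _ YQ) _.
apply: emb_trans (emb_uncurry _ _ _) _.
apply: (@emb_trans _ (Q -> seg lam)).
  apply: emb_funl (pow_square theta_inf omega_lim _); exact: inhabits (i c, i c).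
by apply: emb_funl Q_kappa; exact: inhabits (i c).
Qed.

Lemma Gamma_ge2 xi : otwo <= Gamma theta alpha xi.
Proof.
elim/(well_founded_ind ord_wf): xi => xi IH.
have [->|x0] := eqVneq xi ozero; first by rewrite Gamma0.
have [[eta E]|nS] := EM (exists eta, xi = osucc eta).
  rewrite E GammaS (le_trans (IH eta _)) ?E ?lt_osucc //.
  by rewrite ltW // (lt_trans (base_lt_pow _)) // (proj2 (csuccP _)).
have xl : is_limit xi.
  by split; [exact/eqP|move=> b E; apply: nS; exists b].
exact: Gamma_limit_ge2.
Qed.

Lemma Gamma_mono xi eta : eta < xi -> Gamma theta alpha (osucc eta) <= Gamma theta alpha xi.
Proof.
elim/(well_founded_ind ord_wf): xi eta => xi IH eta ex.
have [[zeta E]|nS] := EM (exists zeta, xi = osucc zeta).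
  move: ex; rewrite E osuccP le_eqVlt => /orP[/eqP->//|ez].
  rewrite (le_trans (IH zeta _ _ ez)) ?E ?lt_osucc // GammaS.
  by rewrite ltW // (lt_trans (base_lt_pow _)) // (proj2 (csuccP _)).
have xl : is_limit xi.
  split=> [x0|b E]; last by apply: nS; exists b.
  by move: ex; rewrite x0 ltNge ozero_le.
rewrite (Gamma_limit _ _ xl); exact: (proj1 (osup_segP _ _)) (limit_osucc xl ex).
Qed.

End ColourCount.

(** * Trees of large rank have homogeneous subtrees *)

Lemma no_descent (u : nat -> Ord) : ~ forall n, u n.+1 < u n.
Proof.
move=> H; suff K a : forall n, u n = a -> False by exact: (K (u 0%N) 0%N).
by elim/(well_founded_ind ord_wf): a => a IH n E; apply: (IH _ _ n.+1 erefl); rewrite -E.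
Qed.

Lemma wf_no_chain (T : Type) (R : T -> T -> Prop) :
  (forall s : nat -> T, ~ forall n, R (s n.+1) (s n)) -> well_founded R.
Proof.
move=> H v; apply: contrapT => nv.
have /choice[g gP] : forall x, exists y, ~ Acc R x -> R y x /\ ~ Acc R y.
  move=> x; have [ax|nx] := EM (Acc R x); first by exists x.
  have [|y []] := @contrapT (exists y, R y x /\ ~ Acc R y); last by exists y.
  move=> K; apply: nx; constructor=> y yx; apply: contrapT => ny.
  by apply: K; exists y.
pose s n := iter n g v.
have nA n : ~ Acc R (s n) by elim: n => //= n /gP[].
by apply: (H s) => n; have [] := gP _ (nA n).
Qed.

(** [R y x] reads: [y] is a child of [x].  Lower bounds for the rank
    make sense for every [R], well-founded or not. *)
Inductive rank_ge (X : Type) (R : X -> X -> Prop) (x : X) (rho : Ord) : Prop :=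
| RankGe of forall r, r < rho -> exists y, R y x /\ rank_ge R y r.

Lemma rank_ge_le X (R : X -> X -> Prop) x r s :
  r <= s -> rank_ge R x s -> rank_ge R x r.
Proof. by move=> rs [H]; constructor=> t tr; apply: H; exact: lt_le_trans tr rs. Qed.

Lemma rank_exact X (R : X -> X -> Prop) : well_founded R -> forall x rho,
  rank_ge R x rho -> exists y, rank_ge R y rho /\ ~ rank_ge R y (osucc rho).
Proof.
move=> wf; elim/(well_founded_ind wf) => x IH rho xr.
have [[H]|nx] := EM (rank_ge R x (osucc rho)); last by exists x.
have [y [yx yr]] := H rho (lt_osucc _); exact: IH yx _ yr.
Qed.

(** From a point of rank at least [csucc m] one reaches, for each [r < csucc m], a
    point of rank exactly [r]; these points are distinct. *)
Lemma rank_bound X (R : X -> X -> Prop) (m : Ord) x : well_founded R ->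
  embeds X (seg m) -> ~ rank_ge R x (csucc m).
Proof.
move=> wf Xm H; apply: (@csucc_not_emb m); apply: emb_trans Xm.
have /choice[g gP] : forall r : seg (csucc m),
    exists y, rank_ge R y (val r) /\ ~ rank_ge R y (osucc (val r)).
  move=> r; apply: (rank_exact wf (x := x)); apply: rank_ge_le H.
  exact: ltW (set_valP r).
exists g => r s E; apply: val_inj; have [r1 r2] := gP r; have [s1 s2] := gP s.
rewrite E in r1 r2; case: (ltgtP (val r) (val s)) => // l.
  by case: r2; apply: rank_ge_le s1; rewrite leNgt osuccP -ltNge.
by case: s2; apply: rank_ge_le r1; rewrite leNgt osuccP -ltNge.
Qed.

Definition scons (C : Type) (c : C) (f : nat -> C) n := if n is n'.+1 then f n' else c.

Section Homogeneous.
Variables (X C : Type) (R : X -> X -> Prop) (col : X -> C).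

(** A child in the tree of the pairs (node, colours still to be seen): the nodes
    reached from [(x, f)] are those whose colours after [x] follow [f]. *)
Definition along (q p : X * (nat -> C)) : Prop :=
  [/\ R q.1 p.1, col q.1 = p.2 0%N & q.2 = fun n => p.2 n.+1].

Section Thin.
Variable lam : Ord.

Let S := (nat -> C) -> seg (osucc lam).

(* A chain for [below] yields a sequence [f] of colours along which the values
   of the functions of the chain, each taken at the matching tail of [f],
   decrease. *)
Let below (w v : S) := exists c, forall f, val (w f) < val (v (scons c f)).

Let below_wf : well_founded below.
Proof.
apply: wf_no_chain => s /choice[c cP].
apply: (@no_descent (fun n => val (s n (fun k => c (n + k)%N)))) => n.
have := cP n (fun k => c (n.+1 + k)%N); congr (_ < val (s n _)).
by apply: funext => -[|k] /=; rewrite ?addn0 // addnS addSn.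
Qed.

Let thin x := forall f, ~ rank_ge along (x, f) (osucc lam).

(* [v] lists the exact ranks of [x] along all sequences of colours. *)
Let profile x (v : S) := forall f,
  rank_ge along (x, f) (val (v f)) /\ ~ rank_ge along (x, f) (osucc (val (v f))).

Let thin_profile x : thin x -> exists v, profile x v.
Proof.
move=> tx; suff /choice[v vP] : forall f, exists r : seg (osucc lam),
  rank_ge along (x, f) (val r) /\ ~ rank_ge along (x, f) (osucc (val r)) by exists v.
move=> f; have [nP min] := @leastP [set r | ~ rank_ge along (x, f) (osucc r)] lam (tx f).
set r := least _ in nP min.
have rl : seg (osucc lam) r by rewrite /seg /= osuccP; exact: min (tx f).
exists (SigSub (mem_set rl)); split=> //=; constructor=> s sr.
have [[H]|/min] := EM (rank_ge along (x, f) (osucc s)); last by rewrite leNgt sr.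
exact: H (lt_osucc s).
Qed.

Let rank_profile rho x v : thin x -> profile x v -> rank_ge R x rho -> rank_ge below v rho.
Proof.
elim/(well_founded_ind ord_wf): rho x v => rho IH x v tx vP [H].
constructor=> r rr; have [y [yx yr]] := H r rr.
have up s f : rank_ge along (y, f) s -> rank_ge along (x, scons (col y) f) (osucc s).
  move=> ys; constructor=> t; rewrite osuccP => ts; exists (y, f); split=> //.
  exact: rank_ge_le ts ys.
have ty : thin y.
  by move=> f /up/(rank_ge_le (ltW (lt_osucc _))); exact: tx.
have [w wP] := thin_profile ty; exists w; split; last exact: IH rr _ _ ty wP yr.
exists (col y) => f; rewrite ltNge; apply/negP => le.
apply: (proj2 (vP (scons (col y) f))); apply: up.
exact: rank_ge_le le (proj1 (wP f)).
Qed.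

(** If along every [f] the rank of [x] is at most [lam], map each node to the
    function that gives its rank along each [f].  Passing to a child of colour [c]
    lowers the value at each [f] strictly below the former value at [c] followed
    by [f], so ranks of nodes are bounded by ranks in a well-founded relation on
    the type [S] of these functions. *)
Lemma homogeneous (m : Ord) x : embeds S (seg m) -> rank_ge R x (csucc m) ->
  exists f, rank_ge along (x, f) (osucc lam).
Proof.
move=> Sm xm; apply: contrapT => H.
have tx : thin x by move=> f K; apply: H; exists f.
have [v vP] := thin_profile tx.
exact: (rank_bound (x := v) below_wf Sm) (rank_profile tx vP xm).
Qed.

End Thin.
End Homogeneous.

(** * Sets of bounded size *)

(** Equivalent to an embedding of [A] into [E] ([cov_embP]); unions and images of
    sets enumerated in this partial way need no choice of preimages. *)
Definition covered_by (E T : Type) (A : set T) : Prop :=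
  exists c : E -> option T, forall a, A a -> exists e, c e = Some a.

Lemma cov_embP (E T : Type) (A : set T) : covered_by E A <-> embeds A E.
Proof.
split=> [[c cP]|[f fi]].
  have /choice[g gP] : forall a : A, exists e, c e = Some (val a).
    by move=> a; exact: cP (set_valP a).
  by exists g => a b E'; apply: val_inj; have := gP a; rewrite E' gP => -[].
exists (fun e => if pselect (exists a, f a = e) is left h
                 then Some (val (projT1 (cid h))) else None) => a Aa.
exists (f (SigSub (mem_set Aa))); case: pselect => [h|[]]; last by eexists.
by rewrite (fi _ _ (projT2 (cid h))).
Qed.

Lemma cov_le (E E' T : Type) (A : set T) : embeds E E' -> covered_by E A -> covered_by E' A.
Proof. by move=> EE' /cov_embP H; apply/cov_embP; exact: emb_trans EE'. Qed.

Lemma cov_sub (E T : Type) (A B : set T) : B `<=` A -> covered_by E A -> covered_by E B.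
Proof. by move=> BA [c cP]; exists c => b /BA/cP. Qed.

Lemma cov_bigcup (E E' I T : Type) (P : set I) (F : I -> set T) :
  covered_by E P -> (forall i, P i -> covered_by E' (F i)) ->
  covered_by (E * E') (\bigcup_(i in P) F i).
Proof.
move=> [c cP] HF.
have /choice[d dP] : forall i, exists d : E' -> option T,
    P i -> forall a, F i a -> exists e, d e = Some a.
  move=> i; have [Pi|nPi] := EM (P i); last by exists (fun=> None).
  by have [d dP] := HF i Pi; exists d.
exists (fun p => if c p.1 is Some i then d i p.2 else None) => a [i Pi Fa].
have [e ce] := cP i Pi; have [e' de] := dP i Pi a Fa.
by exists (e, e'); rewrite /= ce.
Qed.

Lemma cov_image (E T U : Type) (A : set T) (r : T -> U -> Prop) :
  (forall x y y', r x y -> r x y' -> y = y') ->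
  covered_by E A -> covered_by E [set u | exists2 a, A a & r a u].
Proof.
move=> rf [c cP].
exists (fun e => if c e is Some a then
   if pselect (exists u, r a u) is left h then Some (projT1 (cid h)) else None
   else None) => u [a Aa au].
have [e ce] := cP a Aa; exists e; rewrite ce; case: pselect => [h|[]]; last by exists u.
by rewrite (rf _ _ _ (projT2 (cid h)) au).
Qed.

Lemma cov_setU (E T : Type) (A B : set T) : embeds (bool * E) E ->
  covered_by E A -> covered_by E B -> covered_by E (A `|` B).
Proof.
move=> EE [c cP] [d dP]; apply: cov_le EE _.
exists (fun p => if p.1 then c p.2 else d p.2) => x [/cP[e ee]|/dP[e ee]].
  by exists (true, e).
by exists (false, e).
Qed.

Lemma cov_supported (E Z : Type) (D : set Z) : covered_by E D ->
  covered_by (E -> nat) [set h : Z -> nat | forall z, ~ D z -> h z = 0%N].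
Proof.
move=> [c cP].
exists (fun u => Some (fun z => if pselect (D z /\ exists e, c e = Some z) is left h
   then u (projT1 (cid (proj2 h))) else 0%N)) => h hD.
exists (fun e => if c e is Some z then h z else 0%N); congr Some.
apply: funext => z; case: pselect => [H|H].
  by rewrite (projT2 (cid (proj2 H))).
by rewrite hD // => Dz; apply: H; split=> //; exact: cP.
Qed.

Lemma card_set1_le (T : Type) (x : T) (k : Ord) : ozero < k -> [set x] #<= seg k.
Proof.
move=> k0; apply/card_leE/cov_embP; exists (fun=> Some x) => _ ->.
by exists (SigSub (mem_set (k0 : seg k ozero))).
Qed.

(** * Winning positions *)

Fixpoint descendant (X : Type) (R : X -> X -> Prop) n (x y : X) : Prop :=
  if n is n'.+1 then exists2 u, descendant R n' x u & R y u else y = x.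

Lemma desc_cons (X : Type) (R : X -> X -> Prop) n x u y :
  R u x -> descendant R n u y -> descendant R n.+1 x y.
Proof.
move=> ux; elim: n y => [|n IH] y /=; first by move->; exists x.
by move=> [v /IH xv vy]; exists v.
Qed.

Section Game.
Variables (L : vocabulary) (M0 M1 : structure L).
Local Notation pmap := Defs.pmap.
Local Notation position := (position M0 M1).
Local Notation move := (move M0 M1).

(** Positions from which Eve can always go on: strategies, which see the history,
    can be traded for this positional notion because the clock decreases. *)
Inductive win (beta theta alpha : Ord) (p : position) : Prop :=
| Win of forall m, adam_legal theta p m ->
    exists q, eve_legal beta theta alpha p m q /\ win beta theta alpha q.

Lemma strategy_win beta theta alpha :
  eve_wins M0 M1 beta theta alpha -> win beta theta alpha (start M0 M1 beta).
Proof.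
move=> [sigma ws].
suff H c ms p : clock p = c -> played beta theta alpha sigma ms p ->
    win beta theta alpha p by apply: H erefl (played_nil _ _ _ _).
elim/(well_founded_ind ord_wf): c ms p => c IH ms p pc pl.
constructor=> m lm; have el := ws _ _ _ pl lm.
exists (sigma (rcons ms m)); split=> //.
apply: (IH _ _ (rcons ms m) _ erefl); last exact: played_rcons pl lm el.
by have [_ [+ _ _ _] _ _ _] := el; rewrite pc.
Qed.

Lemma win_strategy beta theta alpha :
  win beta theta alpha (start M0 M1 beta) -> eve_wins M0 M1 beta theta alpha.
Proof.
move=> w0.
have /choice[f fP] : forall pm : position * move, exists q,
    win beta theta alpha pm.1 -> adam_legal theta pm.1 pm.2 ->
    eve_legal beta theta alpha pm.1 pm.2 q /\ win beta theta alpha q.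
  move=> [p m] /=; have [[w l]|H] :=
    EM (win beta theta alpha p /\ adam_legal theta p m).
    by have [/(_ m l)[q qP]] := w; exists q.
  by exists p => w l; case: H.
pose sigma := foldl (fun p m => f (p, m)) (start M0 M1 beta).
exists sigma.
have sE ms m : sigma (rcons ms m) = f (sigma ms, m).
  by rewrite /sigma -cats1 foldl_cat.
have H ms p : played beta theta alpha sigma ms p -> p = sigma ms /\ win beta theta alpha p.
  elim=> // {}ms {}p m _ [-> w] l _; split=> //.
  by rewrite sE; exact: (proj2 (fP (_, _) w l)).
move=> ms p m /H[-> w] l; rewrite sE.
exact: (proj1 (fP (_, _) w l)).
Qed.

Lemma partial_iso_sub (g h : M0 -> option M1) :
  (forall x y, h x = Some y -> g x = Some y) -> partial_iso g -> partial_iso h.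
Proof.
move=> hg [gi gs]; split=> [x x' y /hg E /hg E'|n phi v w vw].
  exact: gi E E'.
by apply: gs => i; exact/hg.
Qed.

(** * Answers in the short game *)

Definition settled (p : position) (z : M0 + M1) : Prop :=
  match z with
  | inl x => exists y, pmap p x = Some y
  | inr y => exists x, pmap p x = Some y
  end.

Lemma extends_settled (p q : position) z : extends q p -> settled p z -> settled q z.
Proof. by move=> [_ _ pq _]; case: z => x [y /pq E]; exists y. Qed.

Lemma extends_dom (p q : position) z : extends q p -> dom p z -> dom q z.
Proof. by move=> [_ [d0 d1] _ _]; case: z => x; [exact: d0|exact: d1]. Qed.

Lemma position_settled beta theta alpha (p : position) z :
  is_position beta theta alpha p -> dom p z -> height p z = ozero -> settled p z.
Proof. by move=> [_ _ _ _ [h0 h1]]; case: z => x; [exact: h0|exact: h1]. Qed.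

Definition dsum (D0 : set M0) (D1 : set M1) : set (M0 + M1) :=
  [set z | match z with inl x => D0 x | inr y => D1 y end].

(** The answer of Eve in the short game, at position [p] after the move [m], copied
    from a position [q] of the long game with the finite heights [h].  The domains
    contain what [m] asks for and are closed under [pmap q] and its inverse, so
    that the restriction of [pmap q] is defined wherever [pmap q] is. *)
Section Reply.
Variables (p : position) (m : move) (q : position) (h : M0 + M1 -> nat).

Definition core0 : set M0 := dom0 p `|` mset0 m.
Definition core1 : set M1 := dom1 p `|` mset1 m.
Definition hull0 : set M0 := core0 `|` [set x | exists2 y, core1 y & pmap q x = Some y].
Definition hull1 : set M1 := core1 `|` [set y | exists2 x, core0 x & pmap q x = Some y].

Definition reply : position :=
  Position (mclock m) hull0 hull1
    (fun x => if pselect (hull0 x) then pmap q x else None) (natO \o h).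

End Reply.

Lemma reply_pmap p m q h x y : partial_iso (pmap q) ->
  pmap (reply p m q h) x = Some y <->
  [/\ pmap q x = Some y, hull0 p m q x & hull1 p m q y].
Proof.
move=> [gi _] /=; case: pselect => hx /=; last by split=> // -[].
split=> [E|[]//]; split=> //; case: hx => [cx|[y' cy' E']].
  by right; exists x.
by left; move: E'; rewrite E => -[->].
Qed.

Lemma reply_settled p m q h z : partial_iso (pmap q) ->
  dom (reply p m q h) z -> settled q z -> settled (reply p m q h) z.
Proof.
move=> gp; have [gi _] := gp; case: z => [x|b] dz [y E]; exists y; apply/reply_pmap => //; split=> //.
  by case: (dz) => [cx|[y' cy' E']]; [right; exists x|left; move: E'; rewrite E => -[->]].
by case: (dz) => [cb|[x' cx' E']]; [right; exists b|left; rewrite (gi _ _ _ E E')].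
Qed.

(** * From the long game to the short game *)

Section Transfer.
Variables (theta alpha beta : Ord).
Hypothesis theta_inf : infinite_cardinal theta.
Hypothesis omega_lim : is_limit omega.
Hypothesis alpha_gt0 : ozero < alpha.

(* The side condition of [cov_setU], found by [//]. *)
Let tmb := theta_mul_bool theta_inf omega_lim.
Let E := seg theta -> bool.

Local Notation win' := (win beta theta omega).
Local Notation is_position' := (is_position beta theta omega).
Local Notation eve_legal' := (eve_legal beta theta omega).

Definition refutes (p : position) (m : move) : Prop :=
  adam_legal theta p m /\ forall q, eve_legal' p m q -> ~ win' q.

(** A position without refutation gets a move with empty sets, which adds nothing to
    the joint move below. *)
Definition refutation (p : position) : move :=
  if pselect (exists m, refutes p m) is left h then projT1 (cid h)
  else Move ozero set0 set0.

Lemma refutationP p : ~ win' p -> refutes p (refutation p).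
Proof.
move=> np; rewrite /refutation; case: pselect => [h|H]; first exact: projT2 (cid h).
case: np; constructor=> m lm; apply: contrapT => K; apply: H; exists m; split=> // q lq wq.
by apply: K; exists q.
Qed.

Lemma refutation_small p :
  covered_by (seg theta) (mset0 (refutation p)) /\
  covered_by (seg theta) (mset1 (refutation p)).
Proof.
rewrite /refutation; case: pselect => [h|_] /=.
  by have [[_ /card_leE/cov_embP ? /card_leE/cov_embP ?] _] := projT2 (cid h).
by split; exists (fun=> None).
Qed.

(** A position of the long game, with the positions of the short game that are
    simulated next to it. *)
Definition node : Type := position * set position.

(** All positions reached when Adam plays his refutation at some [p] in [F] and Eve
    answers by a [reply] copied from [q].  Requiring [h] to vanish off the domain
    makes the positions as few as the functions on a set of size [theta]. *)
Definition next_family (F : set position) (q : position) : set position :=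
  \bigcup_(p in F) ((fun h => reply p (refutation p) q h) @`
     [set h | forall z, ~ dsum (hull0 p (refutation p) q) (hull1 p (refutation p) q) z ->
              h z = 0%N]).

(** Adam cannot tell which of the simulated plays will be continued, so he serves
    all of them at once. *)
Definition joint_move (c : Ord) (F : set position) : move :=
  Move c (\bigcup_(p in F) mset0 (refutation p)) (\bigcup_(p in F) mset1 (refutation p)).

Local Notation Gm := (Gamma theta alpha).
Local Notation eve_legalG := (eve_legal (Gm beta) (cexp otwo theta) alpha).

Definition child (y x : node) : Prop :=
  (exists c, eve_legalG x.1 (joint_move c x.2) y.1) /\ y.2 = next_family x.2 y.1.

Definition small (p : position) : Prop :=
  covered_by (seg theta) (dom0 p) /\ covered_by (seg theta) (dom1 p).

Lemma hull_small p q : partial_iso (pmap q) -> small p ->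
  covered_by (seg theta) (hull0 p (refutation p) q) /\
  covered_by (seg theta) (hull1 p (refutation p) q).
Proof.
move=> [gi _] [p0 p1]; have [m0 m1] := refutation_small p.
have c0 : covered_by (seg theta) (core0 p (refutation p)) by exact: cov_setU.
have c1 : covered_by (seg theta) (core1 p (refutation p)) by exact: cov_setU.
split; apply: cov_setU => //.
  apply: (cov_image (r := fun y x => pmap q x = Some y)) => // y x x'; exact: gi.
by apply: (cov_image (r := fun x y => pmap q x = Some y)) => // x y y' -> -[].
Qed.

Lemma dsum_small D0 D1 : covered_by (seg theta) D0 -> covered_by (seg theta) D1 ->
  covered_by (seg theta) (dsum D0 D1).
Proof.
move=> c0 c1.
apply: (@cov_sub _ _ ([set z | exists2 x, D0 x & inl x = z] `|`
                      [set z | exists2 x, D1 x & inr x = z])).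
  by case=> [x|y] dz; [left; exists x|right; exists y].
by apply: cov_setU => //; apply: cov_image => // x y y' -> ->.
Qed.

(** At most [omega ^ theta] height functions for each of the [2 ^ theta] members of
    [F]. *)
Lemma next_small F q : partial_iso (pmap q) -> covered_by E F -> (forall p, F p -> small p) ->
  covered_by E (next_family F q) /\ forall p, next_family F q p -> small p.
Proof.
move=> gq cF sF; split; last first.
  by move=> _ [p /sF sp [h _ <-]]; exact: hull_small.
apply: (cov_le (pow_square theta_inf omega_lim _)); apply: cov_bigcup => // p /sF sp.
apply: (cov_le (pow_nat_base theta_inf omega_lim)).
have [h0 h1] := hull_small gq sp.
have := cov_image (r := fun h r => reply p (refutation p) q h = r) _
  (cov_supported (dsum_small h0 h1)).
by apply=> x y y' -> ->.
Qed.

Lemma joint_small F : covered_by E F ->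
  covered_by E (mset0 (joint_move ozero F)) /\ covered_by E (mset1 (joint_move ozero F)).
Proof.
move=> cF; have HE : embeds (E * seg theta) E.
  apply: emb_trans (pow_square theta_inf omega_lim _).
  have [f fi] := pow_theta theta.
  by exists (fun p => (p.1, f p.2)) => -[a b] [c d] [-> /fi ->].
by split; apply: (cov_le HE); apply: cov_bigcup => // p _; have [] := refutation_small p.
Qed.

Lemma node_rank (x : node) : win (Gm beta) (cexp otwo theta) alpha x.1 -> covered_by E x.2 ->
  (forall p, x.2 p -> small p) -> rank_ge child x (clock x.1).
Proof.
move c : (clock x.1) => cx; elim/(well_founded_ind ord_wf): cx x c => cx IH x xc [w] cF sF.
constructor=> r rc; have [j0 j1] := joint_small cF.
have [HE _] := card_pow2 theta.
have [|q [lq wq]] := w (joint_move r x.2).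
  by split; rewrite /= ?xc //; apply/card_leE/cov_embP; exact: cov_le HE _.
have [[_ _ [gq _] _ _] _ cq _ _] := lq.
have [n1 n2] := next_small gq cF sF.
exists (q, next_family x.2 q); split; first by split=> //; exists r.
exact: IH.
Qed.

(** No position of the short game is lost for Eve if it is simulated next to a node
    of rank at least [Gamma xi], [xi] being its clock, in a tree [R] of plays of the long
    game, and if its heights keep their promise: an element of height [n] is in the
    domain or range of the map at all [R]-descendants [n] generations later.

    Adam's refutation [m] asks for a set [D] with the old domain.  Colour each node
    [u] by the heights that its position gives to [D].  [Gamma] is large enough to
    leave a subtree of rank more than [Gamma (mclock m)] where the colours follow
    one sequence [f].  Each [z] in [D] gets settled in that subtree within a number
    of generations that depends only on [z], since otherwise the values [f n z]
    would decrease for ever.  Eve answers from a child [y] of [x], with these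
    numbers as heights, and the situation recurs with the subtree above [y]. *)
Lemma transfer xi : forall (X : Type) (R : X -> X -> Prop) (pos : X -> node) (x : X)
    (p : position),
  (forall u v, R u v -> child (pos u) (pos v)) ->
  rank_ge R x (Gm xi) -> clock p = xi -> (pos x).2 p -> is_position' p -> ~ win' p ->
  (forall z, dom p z -> dom (pos x).1 z) ->
  (forall a b, pmap p a = Some b -> pmap (pos x).1 a = Some b) ->
  (forall z, dom p z -> exists n, height p z = natO n /\
     forall y, descendant R n x y -> settled (pos y).1 z) ->
  False.
Proof.
elim/(well_founded_ind ord_wf): xi => xi IH X R pos x p Rc xr pc Fp pp np domp mapp prom.
have [[mc _ _] mP] := refutationP np.
set m := refutation p in mc mP.
have [pb [/card_leE/cov_embP p0 /card_leE/cov_embP p1] [_ pgd] _ _] := pp.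
have [m0 m1] := refutation_small p; rewrite -/m in m0 m1.
pose D := dsum (core0 p m) (core1 p m).
have Dt : covered_by (seg theta) D by apply: dsum_small; exact: cov_setU.
pose C := D -> seg alpha.
pose col (u : X) (z : D) : seg alpha :=
  if pselect (height (pos u).1 (val z) < alpha) is left h
  then SigSub (mem_set (h : seg alpha _)) else SigSub (mem_set (alpha_gt0 : seg alpha _)).
have [f fr] : exists f, rank_ge (along R col) (x, f) (osucc (Gm (mclock m))).
  apply: homogeneous; first apply: (colour_card theta_inf omega_lim alpha_gt0).
  - exact/cov_embP.
  - exact: Gamma_ge2.
  rewrite pc in mc; apply: rank_ge_le xr; rewrite -GammaS.
  exact: Gamma_mono.
have [Hf] := fr; have [[y f'] [yx yr]] := Hf _ (lt_osucc _); clear Hf.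
have [/= Ryx cy f'E] := yx; rewrite /= in Ryx.
set A := along R col in yx yr *.
have childP u v : R u v -> [/\ is_position (Gm beta) (cexp otwo theta) alpha (pos u).1,
     extends (pos u).1 (pos v).1 & (pos u).2 = next_family (pos v).2 (pos u).1].
  by move=> /Rc[[c [? ? _ _ _]] ?].
have Dy z : D z -> dom (pos y).1 z.
  have [[c [_ ey _ j0 j1]] _] := Rc _ _ Ryx.
  case: z => [a|b] [pa|ma].
  - exact: (extends_dom (z := inl a)) ey (domp (inl a) pa).
  - by apply: j0; exists p.
  - exact: (extends_dom (z := inr b)) ey (domp (inr b) pa).
  - by apply: j1; exists p.
have descP n w : descendant A n (y, f') w ->
    [/\ descendant R n y w.1, is_position (Gm beta) (cexp otwo theta) alpha (pos w.1).1,
     forall z, dom (pos y).1 z -> dom (pos w.1).1 z,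
     forall z, settled (pos y).1 z -> settled (pos w.1).1 z &
     col w.1 = f n /\ w.2 = fun k => f (n.+1 + k)%N].
  elim: n w => [|n IHn] w /=.
    by move->; split=> //; have [] := childP _ _ Ryx.
  move=> [u /IHn[d up ud us [cu fu]] [wu cw fw]].
  have [wp we _] := childP _ _ wu; split=> //.
  - by exists u.1.
  - by move=> z /ud; exact: extends_dom.
  - by move=> z /us; exact: extends_settled.
  split; first by rewrite cw fu addn0.
  by rewrite fw fu; apply: funext => k; rewrite addnS -addSn.
(* [n] may be promised for [z]: the least such [n] will be its height. *)
pose good n z := forall w, descendant A n (y, f') w -> settled (pos w.1).1 z.
(* Heights that are not yet [0] decrease from [u] to its child [w], and an
   element not settled at [w] has non-zero height at [u]. *)
have goodD z : D z -> exists n, good n z.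
  move=> Dz; apply: contrapT => H.
  pose zD : D := SigSub (mem_set Dz).
  apply: (@no_descent (fun n => val (f n zD))) => n.
  have [w dw nw] : exists2 w, descendant A n.+1 (y, f') w & ~ settled (pos w.1).1 z.
    apply: contrapT => K; apply: H; exists n.+1 => w dw; apply: contrapT => nw.
    by apply: K; exists w.
  have [_ wp wd _ [<- _]] := descP _ _ dw.
  have [u du [wu _ _]] := dw.
  have [_ up ud _ [<- _]] := descP _ _ du.
  have [_ we _] := childP _ _ wu.
  have colE v : is_position (Gm beta) (cexp otwo theta) alpha (pos v).1 ->
      dom (pos v).1 z -> val (col v zD) = height (pos v).1 z.
    by move=> [_ _ _ hv _] dv; rewrite /col; case: pselect => // -[]; exact: hv.
  rewrite !colE //; [|exact/ud/Dy|exact/wd/Dy].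
  have [_ _ _ /(_ z (ud _ (Dy _ Dz)))[_]] := we; apply.
  rewrite lt_neqAle ozero_le andbT; apply/eqP => h0; apply: nw.
  exact: extends_settled we (position_settled up (ud _ (Dy _ Dz)) (esym h0)).
have [yp yext yF] := childP _ _ Ryx.
have [_ _ [giso gdom] _ _] := yp.
pose H0 := hull0 p m (pos y).1; pose H1 := hull1 p m (pos y).1.
(* The elements that the hull adds to [D] are matched by [pmap (pos y).1]
   already. *)
have goodH z : dsum H0 H1 z -> exists n, good n z.
  have set0 z' : settled (pos y).1 z' -> exists n, good n z'.
    by move=> sz; exists 0%N => w /descP[_ _ _ + _]; apply.
  case: z => [a|b] [cz|[t ct E']].
  - exact: goodD.
  - by apply: set0; exists t.
  - exact: goodD.
  - by apply: set0; exists t.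
have /choice[h hP] : forall z, exists n,
    (dsum H0 H1 z -> good n z /\ forall k, good k z -> (n <= k)%N) /\
    (~ dsum H0 H1 z -> n = 0%N).
  move=> z; have [Hz|nz] := EM (dsum H0 H1 z); last by exists 0%N.
  have [n gn] := goodH z Hz.
  have ex : exists n, `[< good n z >] by exists n; apply/asboolP.
  case: (ex_minnP ex) => k /asboolP gk min; exists k; split=> // _; split=> // j gj.
  by apply: min; apply/asboolP.
pose q := reply p m (pos y).1 h.
have domq z : dom q z -> dsum H0 H1 z by case: z.
have mapq a b : pmap q a = Some b -> pmap (pos y).1 a = Some b.
  by move=> /(reply_pmap p m h _ _ giso)[].
have sp : small p by split.
have qp : is_position' q.
  split.
  - by rewrite /= (le_trans (ltW mc)).
  - by have [h0 h1] := hull_small giso sp; split; apply/card_leE/cov_embP.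
  - split; first exact: partial_iso_sub mapq giso.
    by move=> a b /(reply_pmap p m h _ _ giso)[].
  - by move=> z _; exact: limit_iter (limit_gt0 _).
  have S z : dom q z -> height q z = ozero -> settled q z.
    move=> dz /natO_eq0 hz; apply: reply_settled => //.
    have [/(_ (domq _ dz))[gz _] _] := hP z.
    by apply: (gz (y, f')); rewrite hz.
  by split=> a; [exact: (S (inl a))|exact: (S (inr a))].
have pq z : dom p z -> dsum H0 H1 z by case: z => a pa; left; left.
have qe : extends q p.
  split=> //.
  - by split=> a pa; left; left.
  - move=> a b E'; apply/reply_pmap => //.
    have [da db] := pgd _ _ E'; split; [|by left; left|by left; left].
    by have [_ _ e _] := yext; apply/e/mapp.
  move=> z dz; have [n [-> hn]] := prom z dz.
  have [/(_ (pq z dz))[_ min] _] := hP z.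
  case: n hn => [|n] hn.
    have hz : h z = 0%N.
      apply/eqP; rewrite -leqn0; apply: min => w /descP[_ _ _ + _]; apply.
      exact: extends_settled yext (hn x erefl).
    by rewrite /q /= hz ltxx.
  have le : (h z <= n)%N.
    apply: min => w /descP[dw _ _ _ _]; apply: hn; exact: desc_cons Ryx dw.
  by split=> [|_]; [apply: natO_le; exact: leqW|exact: natO_lt].
have qw : ~ win' q.
  by apply: mP; split=> // a ma; left; right.
apply: (IH (mclock m) _ _ A (fun w => pos w.1) (y, f') q) => //.
- by rewrite -pc.
- by move=> u v [/Rc].
- rewrite /= yF; exists p => //; exists h => // z /(proj2 (hP z)); exact.
- move=> [a|b] [cz|[t ct E']].
  + exact: (Dy (inl a)).
  + exact: (proj1 (gdom _ _ E')).
  + exact: (Dy (inr b)).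
  + exact: (proj2 (gdom _ _ E')).
by move=> z dz; exists (h z); have [/(_ (domq _ dz))[gz _] _] := hP z.
Qed.

End Transfer.

Lemma win_empty beta theta p : (M0 -> False) -> (M1 -> False) ->
  clock p <= beta -> partial_iso (pmap p) -> win beta theta omega p.
Proof.
move=> n0 n1; move c : (clock p) => cp.
elim/(well_founded_ind ord_wf): cp p c => cp IH p pc cb pi; constructor=> m [mc s0 s1].
have none (z : M0 + M1) : False by case: z => x; [exact: n0 x|exact: n1 x].
have mb : mclock m <= beta by rewrite (le_trans (ltW mc)) // pc.
exists (Position (mclock m) (mset0 m) (mset1 m) (pmap p) (height p)); split; last first.
  by apply: IH => //=; rewrite -pc.
split=> //; split=> //.
by split=> x; [case: (none (inl x))|case: (none (inr x))].
Qed.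

End Game.

Theorem theorem3p13 (theta alpha beta : Ord)
  (theta_inf : infinite_cardinal theta)
  (alpha_lt : alpha < csucc (cexp otwo theta))
  (beta_lim : is_limit beta)
  (L : vocabulary) (M0 M1 : structure L) :
  eve_wins M0 M1 (Gamma theta alpha beta) (cexp otwo theta) alpha ->
  eve_wins M0 M1 beta theta omega.
Proof.
move=> /strategy_win w; apply: win_strategy.
have [omega_lim _] := @leastP is_limit beta beta_lim.
have gt0 : ozero < Gamma theta alpha beta.
  by apply: lt_le_trans (Gamma_limit_ge2 _ _ beta_lim); exact: (@natO_lt 0 2).
have piso : partial_iso (fun _ : M0 => None : option M1).
  have [/(_ (Move ozero set0 set0))[|q [[[_ _ [giso _] _ _] _ _ _ _] _]]] := w.
    by split=> //; exact: card_ge0.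
  by apply: partial_iso_sub giso.
have pow_gt0 : ozero < cexp otwo theta.
  have [[g _] _] := card_pow2 theta.
  exact: le_lt_trans (ozero_le _) (@set_valP _ _ (g (fun=> true))).
(* For [alpha = 0] a position of the long game has empty domain, so Eve survives
   one move only if both structures are empty. *)
have [a0|a0] := EM (ozero < alpha); last first.
  have alpha0 c : ~ c < alpha.
    by move=> ca; apply: a0; exact: le_lt_trans (ozero_le c) ca.
  have empty (m : move M0 M1) (z : M0 + M1) : adam_legal (cexp otwo theta)
      (start M0 M1 (Gamma theta alpha beta)) m -> dsum (mset0 m) (mset1 m) z -> False.
    move=> l mz; have [/(_ m l)[q [[[_ _ _ hq _] _ _ q0 q1] _]]] := w.
    by apply: (alpha0 (height q z)); apply: hq; case: z mz => x; [exact: q0|exact: q1].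
  apply: win_empty => // x.
    by apply: (@empty (Move ozero [set x] set0) (inl x)) => //; split=> //; exact: card_set1_le.
  by apply: (@empty (Move ozero set0 [set x]) (inr x)) => //; split=> //; exact: card_set1_le.
apply: contrapT => nw.
pose x : node M0 M1 := (start M0 M1 (Gamma theta alpha beta), [set start M0 M1 beta]).
apply: (@transfer L M0 M1 theta alpha beta theta_inf omega_lim a0 beta _
  (@child L M0 M1 theta alpha beta) id x (start M0 M1 beta)) => //.
- apply: (node_rank theta_inf omega_lim (x := x)) => //.
    by exists (fun=> Some (start M0 M1 beta)) => _ ->; exists (fun=> true).
  by move=> _ ->; split; exists (fun=> None).
- by split=> //; case=> a [].
- by case=> a [].
Qed.
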